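(* Let $G$ be a subgroup of the symmetric group $S_m$, let $U$ and $V$ be unitary spaces with orthonormal bases $\{u_1,\dots,u_r\}$ and $\{e_1,\dots,e_n\}$ respectively, let $\mathfrak{X}$ be an irreducible unitary representation of $G$ over $U$, and suppose $\mathfrak{X}$ affords the irreducible character $\chi$ of $G$. If $j\in\bar{\mathcal{D}}$ and $1\le i\le n$, then $$\dim V^{\mathfrak{X}}_{ij}(G)=[\chi,1_{G_j}].$$
   Context: A unitary space is a finite-dimensional complex vector space equipped with an inner product. A unitary representation of $G$ over $U$ is a group homomorphism from $G$ to the unitary operators on $U$; its character is $\chi(\sigma)=\operatorname{tr}\mathfrak{X}(\sigma)$. $\times^{m}V$ is the Cartesian product of $m$ copies of $V$. For $\sigma\in G$, $Q(\sigma)(v_1,\dots,v_m)=(v_{\sigma^{-1}(1)},\dots,v_{\sigma^{-1}(m)})$ on $\times^m V$, and $C_{\mathfrak{X}}=\frac{1}{|G|}\sum_{\sigma\in G}\mathfrak{X}(\sigma)\otimes Q(\sigma)$ on $U\otimes\times^m V$. For $1\le i\le n$, $1\le j\le m$, $e_{ij}=(\delta_{1j}e_i,\dots,\delta_{mj}e_i)\in\times^m V$ (the tuple with $e_i$ in position $j$ and $0$ elsewhere). The generalized cyclic subspace is $V^{\mathfrak{X}}_{ij}(G)=\operatorname{span}\{C_{\mathfrak{X}}(u_k\otimes e_{ij}): 1\le k\le r\}$. $G_j$ is the stabilizer of $j$ in $G$, $T_j=\frac{1}{|G_j|}\sum_{\sigma\in G_j}\mathfrak{X}(\sigma)$, and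 $[\chi,1_{G_j}]=\frac{1}{|G_j|}\sum_{\sigma\in G_j}\chi(\sigma)$ (the inner product of the restriction of $\chi$ to $G_j$ with the principal character of $G_j$). $\Omega=\bigcup_{k=1}^r\{1\le j\le m: T_ju_k\ne0\}=\{1\le j\le m: T_j\neq 0\}$. $\mathcal{D}$ is a set of representatives of the orbits of $G$ on $\{1,\dots,m\}$, and $\bar{\mathcal{D}}=\mathcal{D}\cap\Omega$. *)

(* Defs.v *)
From HB Require Import structures.
From mathcomp Require Export all_boot all_order all_algebra all_fingroup.
From mathcomp Require Export sesquilinear.
From mathcomp Require Export reals.
From mathcomp Require Export complex.

Set Implicit Arguments.
Unset Strict Implicit.
Unset Printing Implicit Defensive.

Import GRing.Theory Num.Theory passmx.
Local Open Scope ring_scope.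

Lemma linfunE (K : fieldType) (U W : vectType K) (f : U -> W) :
  linear f -> linfun f =1 f.
Proof.
move=> lin u.
pose L := GRing.isLinear.Build K U W *:%R f lin.
pose F : {linear U -> W} := HB.pack f L.
exact: (lfunE F u).
Qed.

(* Finite-dimensional tensor product U (x) W, realised as Hom(U^*, W), with
   u (x) w the map phi |-> phi(u) w; [tens_bilinear] and [tens_universal] give
   its universal property. *)
Definition tensor (K : fieldType) (U W : vectType K) : vectType K :=
  'Hom('Hom(U, K^o), W).

Definition tens (K : fieldType) (U W : vectType K) (u : U) (w : W) :
    tensor U W :=
  linfun (fun phi : 'Hom(U, K^o) => (phi u : K) *: w).

(* A (x) B sends f to B o f o A^*, where A^* phi = phi o A; on pure tensors it
   is given by [tensfE]. *)
Definition tensf (K : fieldType) (U W : vectType K)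
    (A : 'End(U)) (B : 'End(W)) : 'End(tensor U W) :=
  linfun (fun f : tensor U W =>
    (B \o f \o linfun (fun phi : 'Hom(U, K^o) => phi \o A))%VF).

Section TensorTheory.
Variables (K : fieldType) (U W : vectType K).

Lemma tensE (u : U) (w : W) (phi : 'Hom(U, K^o)) :
  tens u w phi = (phi u : K) *: w.
Proof.
rewrite /tens linfunE // => a f g.
by rewrite add_lfunE scale_lfunE scalerDl scalerA.
Qed.

Lemma tens_bilinear : bilinear_for *:%R *:%R (@tens K U W).
Proof.
split=> [w|u] a x y; apply/lfunP=> phi; rewrite /= add_lfunE scale_lfunE !tensE.
  by rewrite linearP scalerDl scalerA.
by rewrite scalerDr !scalerA mulrC.
Qed.

Lemma tensfE (A : 'End(U)) (B : 'End(W)) (u : U) (w : W) :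
  tensf A B (tens u w) = tens (A u) (B w).
Proof.
have AtE phi : linfun (fun phi : 'Hom(U, K^o) => (phi \o A)%VF) phi
               = (phi \o A)%VF.
  rewrite linfunE // => a f g; apply/lfunP=> x.
  by rewrite !(add_lfunE, scale_lfunE, comp_lfunE).
apply/lfunP=> phi; rewrite /tensf linfunE; last first.
  move=> a f g; apply/lfunP=> p.
  by rewrite !(add_lfunE, scale_lfunE, comp_lfunE) linearP.
by rewrite !comp_lfunE AtE !tensE comp_lfunE linearZ.
Qed.

Lemma tens_universal (Z : vectType K) (b : {bilinear U -> W -> Z}) :
  exists! f : 'Hom(tensor U W, Z), forall u w, f (tens u w) = b u w.
Proof.
pose e := vbasis {:U}.
have eP : basis_of {:U} e := vbasisP _.
pose c k : 'Hom(U, K^o) := linfun (coord e k : U -> K^o).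
have cE k u : c k u = coord e k u :> K.
  by rewrite /c linfunE // => a x y; rewrite linearP.
have bE (f : tensor U W) :
    linfun (fun f : tensor U W => \sum_(k < \dim {:U}) b e`_k (f (c k))) f
      = \sum_(k < \dim {:U}) b e`_k (f (c k)).
  rewrite linfunE // => a g h; rewrite scaler_sumr -big_split /=.
  by apply: eq_bigr => k _; rewrite add_lfunE scale_lfunE linearPr.
have dec (f : tensor U W) : f = \sum_(k < \dim {:U}) tens e`_k (f (c k)).
  apply/lfunP=> phi; rewrite sum_lfunE.
  transitivity (f (\sum_(k < \dim {:U}) (phi e`_k : K) *: c k)).
    congr (f _); apply/lfunP=> u; rewrite sum_lfunE.
    rewrite {1}(coord_basis eP (memvf u)) linear_sum; apply: eq_bigr => k _.
    by rewrite linearZ scale_lfunE cE /=; exact: mulrC.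
  by rewrite linear_sum; apply: eq_bigr => k _; rewrite linearZ tensE.
exists (linfun (fun f : tensor U W => \sum_(k < \dim {:U}) b e`_k (f (c k)))).
split=> [u w|g gP].
  rewrite bE {2}(coord_basis eP (memvf u)) linear_sumlz.
  by apply: eq_bigr => k _; rewrite tensE cE linearZr_LR linearZl_LR.
apply/lfunP=> f; rewrite bE [in RHS](dec f) linear_sum.
by apply: eq_bigr => k _; rewrite /= gP.
Qed.

End TensorTheory.

Definition lftrace (K : fieldType) (U : vectType K) (f : 'End(U)) : K :=
  \tr (mxof (vbasis {:U}) (vbasis {:U}) f).

Lemma lftraceE (K : fieldType) (U : vectType K) (f : 'End(U))
    (r : nat) (e : r.-tuple U) :
  basis_of {:U} e -> lftrace f = \sum_i coord e i (f e`_i).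
Proof.
move=> eP; have dr : r = \dim {:U} by rewrite (size_basis eP).
move: e eP; rewrite {r}dr => e eP; set b := vbasis {:U}.
have bP : basis_of {:U} b := vbasisP _.
have -> : lftrace f = \tr (mxof e e f).
  rewrite /lftrace -/b -[f in LHS]comp_lfun1l (mxof_comp b b eP).
  by rewrite mxtrace_mulC -(mxof_comp e e bP) comp_lfun1r.
by apply: eq_bigr => i _; rewrite !mxE /= vecof_delta.
Qed.

Section UnitaryRepresentations.
Variables (C : numClosedFieldType) (m : nat) (G : {group 'S_m}).
Variable U : vectType C.

(* The product of 'S_m satisfies (s * t) j = t (s j), i.e. s * t is t o s in the
   usual notation for composition: a homomorphism from G, whose product is
   composition of permutations, therefore maps s * t to X t o X s. In finite
   dimension, the unitary operators are the linear isometries. *)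
Definition unitary_repr (dU : {dot U for Num.conj}) (X : 'S_m -> 'End(U)) :=
  [/\ X 1%g = \1%VF,
      {in G &, forall s t, X (s * t)%g = (X t \o X s)%VF}
    & {in G, forall s, isometry dU dU (X s)}].

Definition irreducible_repr (X : 'S_m -> 'End(U)) :=
  {:U}%VS <> 0%VS /\
  forall W : {vspace U},
    {in G, forall s, (X s @: W <= W)%VS} -> W = 0%VS \/ W = {:U}%VS.

Definition affords (X : 'S_m -> 'End(U)) (chi : 'S_m -> C) :=
  {in G, forall s, chi s = lftrace (X s)}.

End UnitaryRepresentations.

Definition char_dot (C : numClosedFieldType) (m : nat) (H : {group 'S_m})
    (phi psi : 'S_m -> C) : C :=
  #|H|%:R^-1 * \sum_(s in H) phi s * (psi s)^*.

Definition principal_char (C : numClosedFieldType) (m : nat) : 'S_m -> C :=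
  fun _ => 1.

Lemma char_dot1 (C : numClosedFieldType) (m : nat) (H : {group 'S_m})
    (phi : 'S_m -> C) :
  char_dot H phi (@principal_char C m) = #|H|%:R^-1 * \sum_(s in H) phi s.
Proof. by congr (_ * _); apply: eq_bigr => s _; rewrite conjC1 mulr1. Qed.

Section GeneralizedCyclicSubspaces.
Variables (C : numClosedFieldType) (m : nat) (G : {group 'S_m}).
Variables U V : vectType C.
Variable X : 'S_m -> 'End(U).

Definition cartesian_power : vectType C := {ffun 'I_m -> V}.

Definition Q (s : 'S_m) : 'End(cartesian_power) :=
  linfun (fun v : {ffun 'I_m -> V} => [ffun l => v (s^-1%g l)]).

Lemma QE (s : 'S_m) (v : {ffun 'I_m -> V}) :
  Q s v = [ffun l => v (s^-1%g l)].
Proof. by rewrite /Q linfunE // => a x y; apply/ffunP=> l; rewrite !ffunE. Qed.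

Definition C_X : 'End(tensor U cartesian_power) :=
  #|G|%:R^-1 *: \sum_(s in G) tensf (X s) (Q s).

Definition e_vec n (e : n.-tuple V) (i : 'I_n) (j : 'I_m) : cartesian_power :=
  [ffun l => (l == j)%:R *: tnth e i].

Definition cyclic_subspace r (u : r.-tuple U) n (e : n.-tuple V)
    (i : 'I_n) (j : 'I_m) : {vspace tensor U cartesian_power} :=
  <<[seq C_X (tens (tnth u k) (e_vec e i j)) | k : 'I_r]>>%VS.

Definition stabilizer (j : 'I_m) : {group 'S_m} := 'C_G[j | 'P]%G.

Definition T_op (j : 'I_m) : 'End(U) :=
  #|stabilizer j|%:R^-1 *: \sum_(s in stabilizer j) X s.

Definition Omega r (u : r.-tuple U) : {set 'I_m} :=
  \bigcup_(k < r) [set j | T_op j (tnth u k) != 0].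

End GeneralizedCyclicSubspaces.

Definition orbit_representatives (m : nat) (G : {group 'S_m})
    (D : {set 'I_m}) : bool :=
  is_transversal D (orbit 'P G @: [set: 'I_m]) [set: 'I_m].

Definition orthonormal_basis (C : numClosedFieldType) (U : vectType C)
    (dU : {dot U for Num.conj}) (r : nat) (u : r.-tuple U) : bool :=
  basis_of {:U} u && orthonormal dU u.

(* Main.v *)
Require Import Defs.
Import GRing.Theory Num.Theory.

Local Open Scope ring_scope.
Local Open Scope complex_scope.

(** The generalized cyclic subspace is the image of the linear map
    [L : x |-> C_X (x (x) e_ij)], because the [u_k] span [U].  The point is that
    [L] and the averaging operator [T_j] over the stabilizer [G_j] have the same
    kernel, hence the same rank:
    - [C_X] absorbs [X t (x) Q t] for every [t] in [G], and [Q t] fixes [e_ij]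
      when [t] fixes [j]; averaging over [G_j] gives [L (T_j x) = L x]
      ([symmetrized_tens_T_op]), so [ker T_j <= ker L];
    - in the sum defining [L x], the [j]-th component of the Cartesian power
      receives exactly the terms indexed by [G_j], so this component is
      [|G_j| / |G|] times [T_j x (x) e_i] ([symmetrized_tens_coord]).  As [e_i]
      is nonzero, [ker L <= ker T_j].

    Finally [T_j] is idempotent, being the average of a representation over the
    group [G_j], so its rank is its trace ([lftrace_idempotent]), and by
    linearity the trace of [T_j] is the average of [chi] over [G_j], that is
    [[chi, 1_{G_j}]]. *)

(** [U] is the direct sum of the image and the kernel of an idempotent [f], and
    in a basis adapted to this decomposition [f] is diagonal, with entries 1 on
    the image and 0 on the kernel. *)
Lemma lftrace_idempotent (K : fieldType) (U : vectType K) (f : 'End(U)) :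
  (f \o f)%VF = f -> lftrace f = (\dim (limg f))%:R.
Proof.
move=> ff; have fix_img x : x \in limg f -> f x = x.
  by case/memv_imgP=> y _ ->; rewrite -comp_lfunE ff.
have img_ker : directv (limg f + lker f).
  apply/directv_addP/eqP; rewrite -subv0; apply/subvP=> x.
  by rewrite memv_cap memv_ker memv0 => /andP[/fix_img {2}<-].
have full : (limg f + lker f)%VS = {:U}%VS.
  apply/eqP; rewrite eqEsubv subvf /=; apply/subvP=> x _.
  rewrite -[x](subrK (f x)) addrC memv_add ?memv_img ?memvf //.
  by rewrite memv_ker linearB /= -comp_lfunE ff subrr.
have eP : basis_of {:U} [tuple of vbasis (limg f) ++ vbasis (lker f)].
  by rewrite -[X in basis_of X]full; exact: cat_basis (vbasisP _) (vbasisP _).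
rewrite (lftraceE f eP) big_split_ord /= [X in _ + X]big1 ?addr0 => [|i _].
  (* The dimension of the image is written as the trace of an identity matrix,
     so that the two sums are compared term by term. *)
  rewrite -[RHS](@mxtrace1 K); apply: eq_bigr => i _.
  have vi : (vbasis (limg f) ++ vbasis (lker f))`_i = (vbasis (limg f))`_i.
    by rewrite nth_cat size_tuple ltn_ord.
  rewrite vi fix_img ?vbasis_mem ?mem_nth ?size_tuple // -vi.
  by rewrite (coord_free (lshift _ i)) ?(basis_free eP) // mxE !eqxx.
rewrite nth_cat size_tuple ltnNge leq_addr /= addKn.
have : (vbasis (lker f))`_i \in lker f.
  by rewrite vbasis_mem ?mem_nth ?size_tuple.
by rewrite memv_ker => /eqP ->; rewrite linear0.
Qed.

Lemma lftraceZ_sum (K : fieldType) (U : vectType K) (I : finType)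
    (P : pred I) (a : K) (F : I -> 'End(U)) :
  lftrace (a *: \sum_(k | P k) F k) = a * \sum_(k | P k) lftrace (F k).
Proof.
rewrite (lftraceE _ (vbasisP _)).
under [in RHS]eq_bigr => k _ do rewrite (lftraceE _ (vbasisP _)).
rewrite exchange_big mulr_sumr; apply: eq_bigr => l _.
by rewrite scale_lfunE sum_lfunE linearZ linear_sum.
Qed.

Lemma eq_lker_dim_limg {K : fieldType} {U W W' : vectType K}
    {f : 'Hom(U, W)} {g : 'Hom(U, W')} :
  lker f = lker g -> \dim (limg f) = \dim (limg g).
Proof.
move=> fg; apply: (@addnI (\dim ({:U} :&: lker f))).
by rewrite limg_ker_dim fg limg_ker_dim.
Qed.

(** An element of [tensor U W] is a map out of the dual of [U], so an identity in
    the tensor product says something about vectors of [U] only after it has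
    been tested against all linear forms. *)
Lemma dual_separates (K : fieldType) (U : vectType K) (x : U) :
  (forall phi : 'Hom(U, K^o), phi x = 0) -> x = 0.
Proof.
move=> x0; rewrite (coord_vbasis (memvf x)) big1 // => k _.
have <- : linfun (coord (vbasis {:U}) k : U -> K^o) x
          = coord (vbasis {:U}) k x.
  by rewrite linfunE // => a y z; rewrite linearP.
by rewrite x0 scale0r.
Qed.

Section Averages.
Set Implicit Arguments.
Unset Strict Implicit.

Variables (C : numClosedFieldType) (m : nat) (G : {group 'S_m}).
Variables (U V : vectType C) (X : 'S_m -> 'End(U)).
Hypothesis X_morph : {in G &, forall s t, X (s * t)%g = (X t \o X s)%VF}.

Lemma mem_stabilizer (j : 'I_m) (s : 'S_m) :
  (s \in stabilizer G j) = (s \in G) && (s j == j).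
Proof. by rewrite inE; congr andb; apply/astab1P/eqP. Qed.

Lemma T_opE (j : 'I_m) (x : U) :
  T_op G X j x = #|stabilizer G j|%:R^-1 *: \sum_(s in stabilizer G j) X s x.
Proof. by rewrite scale_lfunE sum_lfunE. Qed.

(** Both [T_j T_j = T_j] and [L T_j = L] are instances, with [g s = X s x] and [f]
    equal to [T_j] and to [L]. *)
Lemma average_fixed (H : {group 'S_m}) (W : vectType C)
    (f : 'Hom(U, W)) (g : 'S_m -> U) :
  {in H, forall s, f (g s) = f (g 1%g)} ->
  f (#|H|%:R^-1 *: \sum_(s in H) g s) = f (g 1%g).
Proof.
move=> fg; rewrite linearZ linear_sum /= (eq_bigr _ fg) sumr_const -scaler_nat.
by rewrite scalerA mulVf ?scale1r // pnatr_eq0 -lt0n cardG_gt0.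
Qed.

Lemma T_op_X (j : 'I_m) (t : 'S_m) (x : U) :
  t \in stabilizer G j -> T_op G X j (X t x) = T_op G X j x.
Proof.
move=> tH; rewrite !T_opE; congr (_ *: _).
rewrite [RHS](reindex_inj (mulgI t)) /=.
apply: eq_big => [s|s sH]; first by rewrite groupMl.
move: tH sH; rewrite !mem_stabilizer => /andP[tG _] /andP[sG _].
by rewrite X_morph // comp_lfunE.
Qed.

Hypothesis X_id : X 1%g = \1%VF.

Lemma T_op_idempotent (j : 'I_m) : (T_op G X j \o T_op G X j)%VF = T_op G X j.
Proof.
apply/lfunP=> x; rewrite comp_lfunE [X in _ X = _]T_opE.
rewrite (average_fixed (g := fun s => X s x)) ?X_id ?id_lfunE // => s sH.
exact: T_op_X.
Qed.

Definition symmetrized_tens (w : cartesian_power m V) :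
    'Hom(U, tensor U (cartesian_power m V)) :=
  linfun (fun x => C_X G V X (tens x w)).

Lemma symmetrized_tensE (w : cartesian_power m V) (x : U) :
  symmetrized_tens w x = C_X G V X (tens x w).
Proof.
rewrite /symmetrized_tens linfunE // => a y z.
by case: (@tens_bilinear C U (cartesian_power m V)) => [bl _]; rewrite bl linearP.
Qed.

Lemma C_X_tens (x : U) (w : cartesian_power m V) :
  C_X G V X (tens x w)
  = #|G|%:R^-1 *: \sum_(s in G) tens (X s x) (Q V s w).
Proof.
rewrite scale_lfunE sum_lfunE; congr (_ *: _).
by apply: eq_bigr => s _; rewrite tensfE.
Qed.

Lemma QM (s t : 'S_m) (w : cartesian_power m V) :
  Q V (s * t)%g w = Q V t (Q V s w).
Proof. by rewrite !QE; apply/ffunP=> l; rewrite !ffunE invMg permM. Qed.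

(** Reindexing the average over [G] by [s |-> t * s].  This product means [s]
    after [t], and [X] and [Q] both turn it into the same order of composition,
    so that [t] acts first on both factors. *)
Lemma C_X_absorbs (t : 'S_m) (x : U) (w : cartesian_power m V) :
  t \in G -> C_X G V X (tens (X t x) (Q V t w)) = C_X G V X (tens x w).
Proof.
move=> tG; rewrite !C_X_tens; congr (_ *: _).
rewrite [RHS](reindex_inj (mulgI t)) /=.
apply: eq_big => [s|s sG]; first by rewrite groupMl.
by rewrite X_morph // comp_lfunE QM.
Qed.

Variables (n : nat) (e : n.-tuple V) (i : 'I_n) (j : 'I_m).

Lemma Q_e_vec (s : 'S_m) : Q V s (e_vec e i j) = e_vec e i (s j).
Proof.
by rewrite QE; apply/ffunP=> l; rewrite !ffunE (canF_eq (permKV s)).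
Qed.

Lemma symmetrized_tens_T_op (x : U) :
  symmetrized_tens (e_vec e i j) (T_op G X j x)
  = symmetrized_tens (e_vec e i j) x.
Proof.
rewrite T_opE (average_fixed (g := fun s => X s x)) ?X_id ?id_lfunE // => s.
rewrite mem_stabilizer !symmetrized_tensE => /andP[sG /eqP sj].
by rewrite -[RHS](C_X_absorbs _ _ sG) Q_e_vec sj.
Qed.

Lemma symmetrized_tens_coord (x : U) (phi : 'Hom(U, C^o)) :
  (symmetrized_tens (e_vec e i j) x phi : {ffun 'I_m -> V}) j
  = (#|stabilizer G j|%:R / #|G|%:R * (phi (T_op G X j x) : C)) *: tnth e i.
Proof.
rewrite symmetrized_tensE C_X_tens scale_lfunE sum_lfunE ffunE sum_ffunE.
have -> : phi (T_op G X j x)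
    = #|stabilizer G j|%:R^-1 * \sum_(s in stabilizer G j) (phi (X s x) : C).
  by rewrite T_opE linearZ linear_sum.
have H_neq0 : #|stabilizer G j|%:R != 0 :> C.
  by rewrite pnatr_eq0 -lt0n cardG_gt0.
rewrite [_ / _]mulrC -mulrA (mulVKf H_neq0).
rewrite -scalerA scaler_suml; congr (_ *: _).
(* Only the [s] with [s j = j] put a nonzero vector in position [j]. *)
rewrite [RHS](eq_bigl _ _ (mem_stabilizer j)) big_mkcondr /=.
apply: eq_bigr => s _; rewrite tensE Q_e_vec !ffunE eq_sym.
by case: eqP => _; rewrite ?scale1r // scale0r scaler0.
Qed.

Lemma lker_symmetrized_tens :
  tnth e i != 0 ->
  lker (symmetrized_tens (e_vec e i j)) = lker (T_op G X j).
Proof.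
move=> ei0; apply/vspaceP=> x; rewrite !memv_ker; apply/eqP/eqP=> [x0|x0].
  apply: dual_separates => phi.
  have := symmetrized_tens_coord x phi; rewrite x0 zero_lfunE ffunE => /esym/eqP.
  rewrite scaler_eq0 (negPf ei0) orbF !mulf_eq0 invr_eq0 !pnatr_eq0.
  by rewrite !eqn0Ngt !cardG_gt0 => /eqP.
by rewrite -symmetrized_tens_T_op x0 linear0.
Qed.

Lemma cyclic_subspace_limg (r : nat) (u : r.-tuple U) :
  <<u>>%VS = {:U}%VS ->
  cyclic_subspace G X u e i j = limg (symmetrized_tens (e_vec e i j)).
Proof.
move=> uU; rewrite -uU limg_span; congr <<_>>%VS.
rewrite -[in RHS](map_tnth_enum u) -map_comp.
by apply: eq_map => k /=; rewrite symmetrized_tensE.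
Qed.

End Averages.

Theorem theorem2p3 (R : realType) (m : nat) (G : {group 'S_m})
    (U V : vectType R[i])
    (dU : {dot U for Num.conj}) (dV : {dot V for Num.conj})
    (r n : nat) (u : r.-tuple U) (e : n.-tuple V)
    (hu : orthonormal_basis dU u) (he : orthonormal_basis dV e)
    (X : 'S_m -> 'End(U))
    (X_repr : unitary_repr G dU X) (X_irr : irreducible_repr G X)
    (chi : 'S_m -> R[i]) (X_chi : affords G X chi)
    (D : {set 'I_m}) (hD : orbit_representatives G D)
    (j : 'I_m) (hj : j \in D :&: Omega G X u) (i : 'I_n) :
  (\dim (cyclic_subspace G X u e i j))%:R
    = char_dot (stabilizer G j) chi (@principal_char R[i] m).
Proof.
have [X1 XM _] := X_repr.
have /andP[/andP[/eqP uU _] _] := hu.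
have /andP[/basis_free e_free _] := he.
have ei0 : tnth e i != 0.
  exact: free_not0 e_free (mem_tnth i e).
rewrite (cyclic_subspace_limg _ _ _ _ _ uU).
rewrite (eq_lker_dim_limg (lker_symmetrized_tens XM X1 j ei0)).
rewrite -lftrace_idempotent ?T_op_idempotent // char_dot1.
rewrite lftraceZ_sum.
congr (_ * _); apply: eq_bigr => s; rewrite mem_stabilizer => /andP[sG _].
by rewrite X_chi.
Qed.
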